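(* Let $\Bbbk$ be a field of characteristic zero. For every $\alpha\in\Bbbk$ with $\alpha\neq 1$, the variety of (nonassociative) $\Bbbk$-algebras with one bilinear product satisfying the identity $$xx^2+\alpha\, x^2x=0$$ has the Nielsen–Schreier property.
   Context: Here $x^2=xx$. A variety of algebras has the Nielsen–Schreier property if every subalgebra of every free algebra of the variety is free in that variety. *)

(* Defs.v *)
From HB Require Import structures.
From mathcomp Require Import all_boot all_order all_algebra.
From mathcomp Require Import boolp classical_sets.

Set Implicit Arguments.
Unset Strict Implicit.
Unset Printing Implicit Defensive.

Import GRing.Theory.
Local Open Scope ring_scope.

(* Neither associativity, commutativity nor a unit is assumed. *)
Record algebra (k : fieldType) := Algebra {
  carrier :> lmodType k;
  amul : {bilinear carrier -> carrier -> carrier}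
}.
Arguments amul {k a}.

Declare Scope alg_scope.
Delimit Scope alg_scope with A.
Notation "x ** y" := (amul x y) (at level 40, left associativity) : alg_scope.
Local Open Scope alg_scope.

Definition alg_hom (k : fieldType) (A B : algebra k) (h : A -> B) : Prop :=
  linear h /\ {morph h : x y / x ** y}.

(* A variety is given by the class V of its algebras; F is free on the family i
   when it has the universal property with respect to the algebras of V. *)
Definition free_on (k : fieldType) (V : algebra k -> Prop)
    (X : Type) (F : algebra k) (i : X -> F) : Prop :=
  V F /\
  forall (B : algebra k) (f : X -> B), V B ->
    exists2 h : F -> B,
      alg_hom h /\ (forall x, h (i x) = f x)
      & forall h' : F -> B,
          alg_hom h' -> (forall x, h' (i x) = f x) -> h' =1 h.

Definition is_free (k : fieldType) (V : algebra k -> Prop) (F : algebra k) :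
    Prop :=
  exists (X : Type) (i : X -> F), free_on V i.

Record subalgebra (k : fieldType) (A : algebra k) := Subalgebra {
  subalg_set :> set A;
  subalg0 : subalg_set 0;
  subalgP : forall (a : k) (x y : A),
    subalg_set x -> subalg_set y -> subalg_set (a *: x + y);
  subalgM : forall x y : A,
    subalg_set x -> subalg_set y -> subalg_set (x ** y)
}.

Section SubalgebraType.
Variables (k : fieldType) (A : algebra k) (S : subalgebra A).

Definition subalg_pred : {pred A} := fun x => x \in subalg_set S.

Fact subalg_submod_closed : submod_closed subalg_pred.
Proof.
split=> [|a x y Sx Sy]; first exact/mem_set/subalg0.
by apply/mem_set/subalgP; apply/set_mem.
Qed.

HB.instance Definition _ :=
  GRing.isSubmodClosed.Build k A subalg_pred subalg_submod_closed.

Definition subalg_type := {x : A | subalg_pred x}.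
HB.instance Definition _ := [isSub of subalg_type for @sval A subalg_pred].
HB.instance Definition _ := [Choice of subalg_type by <:].
HB.instance Definition _ := [SubChoice_isSubLmodule of subalg_type by <:].

Fact subalg_mul_proof (u v : subalg_type) : subalg_pred (val u ** val v).
Proof. by apply/mem_set/subalgM; apply/set_mem/valP. Qed.

Definition subalg_mul (u v : subalg_type) : subalg_type :=
  Sub (val u ** val v) (subalg_mul_proof u v).

Fact subalg_mul_is_bilinear :
  bilinear_for (GRing.Scale.Law.clone _ _ *:%R _)
    (GRing.Scale.Law.clone _ _ *:%R _) subalg_mul.
Proof.
by split=> w a u v; apply: val_inj; rewrite /= ?linearPl ?linearPr.
Qed.

HB.instance Definition _ :=
  bilinear_isBilinear.Build k subalg_type subalg_type subalg_type _ _
    subalg_mul subalg_mul_is_bilinear.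

Definition subalg_algebra : algebra k :=
  @Algebra k subalg_type subalg_mul.

End SubalgebraType.

Definition nielsen_schreier (k : fieldType) (V : algebra k -> Prop) : Prop :=
  forall F : algebra k, is_free V F ->
  forall S : subalgebra F, is_free V (subalg_algebra S).

Definition cubic_variety (k : fieldType) (alpha : k) (A : algebra k) : Prop :=
  forall x : A, x ** (x ** x) + alpha *: ((x ** x) ** x) = 0.

(* Main.v *)
Require Import Defs.
From HB Require Import structures.
From mathcomp Require Import all_boot all_order all_algebra.
From mathcomp Require Import boolp classical_sets functions.

(** Write t(x,y,z) = x(yz) + alpha (yz)x, so that the variety is given by
t(x,x,x) = 0, and let F be free in it.

Square-zero extensions turn freeness into a statement about bilinear maps.
If b : F x F -> M satisfies b(x,xx) + alpha b(xx,x) = 0 (call it a cocycle),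
then F x M with the product (u,m)(v,n) = (uv, b(u,v)) lies in the variety, and
the homomorphism F -> F x M has as its second component a linear map l with
l(uv) = b(u,v) ([free_cocycle]): every cocycle on F is integrable. Also F is
graded by positive degrees ([free_grading]).

The heart of the proof is that for a graded subalgebra G of F, a bilinear map
of bounded degree which is a cocycle on G only can be integrated on G
([all_integrable]). One corrects b by an alternating map d which vanishes on
G x G. As d(x,xx) + alpha d(xx,x) = (1 - alpha) d(x,xx) and alpha is not 1, it
suffices to realize a prescribed cubic form vanishing on G as d(x,xx)
([cubic_integral]). Call H_m the sum of G and of the components of F of degree
at least m. Then xx lies in H_(m+1) for x in H_m, and F_m splits as G_m plus a
complement U_m. If the cubic form already vanishes on H_(m+1), its value at
x in H_m is divisible by the U_m-part r(x) of x: it is psi(r(x); x, x) for some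
psi, symmetrized in the last two arguments. Integrating psi(u; -, -) along
yz + zy for every u gives a map d, pairing r(x) with xx, that removes the form
on H_m ([cubic_step]). This integration concerns lower degree, since r(x) has
degree m > 0; so everything goes by induction on the degree.

Consequently a graded subalgebra G is free on homogeneous generators Y that are
a basis of a complement of GG in G: a map on Y extends to a homomorphism degree
by degree, the values of a homomorphism on lower degrees giving the cocycle
b(u,v) = h(u)h(v) in the next degree ([hom_extension]). For an arbitrary
subalgebra S, the top-degree forms of the elements of S make up a graded
subalgebra G. The homomorphism theta from G to F which sends each generator to
an element of S with that leading form preserves leading forms, so it is an
isomorphism of G with S, and S is free. *)

Set Implicit Arguments.
Unset Strict Implicit.
Unset Printing Implicit Defensive.

Import GRing.Theory.
Local Open Scope ring_scope.
Local Open Scope classical_set_scope.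
Local Open Scope alg_scope.

(** * Linear and multilinear maps, subspaces, bases modulo a subspace *)

Section Forms.
Variable k : fieldType.
Implicit Types U V M : lmodType k.

Section LinearFacts.
Variables (U M : lmodType k) (f : U -> M) (lf : linear f).

Lemma lfD x y : f (x + y) = f x + f y.
Proof. by have := lf 1 x y; rewrite !scale1r. Qed.

Lemma lf0 : f 0 = 0.
Proof. by apply: (addrI (f 0)); rewrite -lfD !addr0. Qed.

Lemma lfZ a x : f (a *: x) = a *: f x.
Proof. by have := lf a x 0; rewrite lf0 !addr0. Qed.

Lemma lfN x : f (- x) = - f x.
Proof. by rewrite -scaleN1r lfZ scaleN1r. Qed.

Lemma lfB x y : f (x - y) = f x - f y.
Proof. by rewrite lfD lfN. Qed.

Lemma lf_sum I (r : seq I) (P : pred I) (F : I -> U) :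
  f (\sum_(i <- r | P i) F i) = \sum_(i <- r | P i) f (F i).
Proof. exact: (big_morph f lfD lf0). Qed.

End LinearFacts.

Definition bilin U V M (b : U -> V -> M) : Prop :=
  (forall y, linear (b^~ y)) /\ (forall x, linear (b x)).

Definition trilin U V (V' : lmodType k) M (t : U -> V -> V' -> M) : Prop :=
  (forall y z, linear (fun x => t x y z)) /\ (forall x, bilin (t x)).

Section BilinearFacts.
Variables (U V M : lmodType k) (b : U -> V -> M) (lb : bilin b).

Lemma blPl a x x' y : b (a *: x + x') y = a *: b x y + b x' y.
Proof. exact: (lb.1 y). Qed.
Lemma blPr x a y y' : b x (a *: y + y') = a *: b x y + b x y'.
Proof. exact: (lb.2 x). Qed.
Lemma blDl x x' y : b (x + x') y = b x y + b x' y.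
Proof. exact: (lfD (lb.1 y)). Qed.
Lemma blDr x y y' : b x (y + y') = b x y + b x y'.
Proof. exact: (lfD (lb.2 x)). Qed.
Lemma bl0l y : b 0 y = 0.
Proof. exact: (lf0 (lb.1 y)). Qed.
Lemma bl0r x : b x 0 = 0.
Proof. exact: (lf0 (lb.2 x)). Qed.
Lemma bl_suml I (r : seq I) (P : pred I) (F : I -> U) y :
  b (\sum_(i <- r | P i) F i) y = \sum_(i <- r | P i) b (F i) y.
Proof. exact: (lf_sum (lb.1 y)). Qed.
Lemma bl_sumr I (r : seq I) (P : pred I) x (F : I -> V) :
  b x (\sum_(i <- r | P i) F i) = \sum_(i <- r | P i) b x (F i).
Proof. exact: (lf_sum (lb.2 x)). Qed.

End BilinearFacts.

Lemma mul_bilin (A : algebra k) : bilin (@amul k A).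
Proof. by split=> w a u v; rewrite ?linearPl ?linearPr. Qed.

Section Algebra_of.
Variables (V : lmodType k) (m : V -> V -> V) (lm : bilin m).

(** A named constant for [m], so that the bilinear structure built from [lm] can
be attached to it. *)
Definition bilin_mul : V -> V -> V := m.
Let bilin_mul_bilinear :
  bilinear_for (GRing.Scale.Law.clone _ _ *:%R _)
    (GRing.Scale.Law.clone _ _ *:%R _) bilin_mul.
Proof. by split=> w; [exact: lm.1 | exact: lm.2]. Qed.

HB.instance Definition _ := bilinear_isBilinear.Build k V V V _ _
  bilin_mul bilin_mul_bilinear.

Definition algebra_of : algebra k := @Algebra k V bilin_mul.

End Algebra_of.

Definition subspace V (W : set V) : Prop :=
  W 0 /\ forall a x y, W x -> W y -> W (a *: x + y).

Section SubspaceFacts.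
Variables (V : lmodType k) (W : set V) (sW : subspace W).

Lemma subspaceD x y : W x -> W y -> W (x + y).
Proof. by move=> Wx Wy; rewrite -[x]scale1r; apply: sW.2. Qed.
Lemma subspaceZ a x : W x -> W (a *: x).
Proof. by move=> Wx; rewrite -[_ *: _]addr0; apply: sW.2 => //; exact: sW.1. Qed.
Lemma subspaceB x y : W x -> W y -> W (x - y).
Proof. by move=> Wx Wy; rewrite addrC -scaleN1r; apply: sW.2. Qed.
Lemma subspace_sum I (r : seq I) (P : pred I) (F : I -> V) :
  (forall i, P i -> W (F i)) -> W (\sum_(i <- r | P i) F i).
Proof. by move=> WF; apply: big_ind => //; [exact: sW.1 | exact: subspaceD]. Qed.

End SubspaceFacts.

(** Defined by its universal property: proofs that every element of a span has
a property then only need that the property defines a subspace, and no finite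
linear combination is ever written down. *)
Definition lspan V (E : set V) : set V :=
  [set x | forall W, subspace W -> E `<=` W -> W x].

Section Span.
Variable V : lmodType k.
Implicit Types (A B E W Y : set V).

Lemma lspan_subspace E : subspace (lspan E).
Proof.
split=> [W sW _|a x y Ex Ey W sW EW]; first exact: sW.1.
by apply: sW.2; [apply: Ex | apply: Ey].
Qed.

Lemma sub_lspan E : E `<=` lspan E.
Proof. by move=> x Ex W _; apply. Qed.

Lemma lspan_min E W : subspace W -> E `<=` W -> lspan E `<=` W.
Proof. by move=> sW EW x; apply. Qed.

Lemma lspan_mono A B : A `<=` B -> lspan A `<=` lspan B.
Proof.
by move=> AB; apply: lspan_min (lspan_subspace B) _ => x /AB; apply: sub_lspan.
Qed.

(** This is the only access needed to the coefficient of a single vector; it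
yields the exchange argument for bases. *)
Lemma lspan_add1 E e x : lspan (E `|` [set e]) x ->
  exists a, lspan E (x - a *: e).
Proof.
apply: (lspan_min (W := [set x | exists a, lspan E (x - a *: e)])).
  split=> [|c y z [a Ey] [b Ez]].
    by exists 0; rewrite scale0r subr0; apply: (lspan_subspace E).1.
  exists (c * a + b); rewrite scalerDl -scalerA opprD addrACA -scalerBr.
  exact: (lspan_subspace E).2.
move=> y [Ey|->]; first by exists 0; rewrite scale0r subr0; apply: sub_lspan.
by exists 1; rewrite scale1r subrr; apply: (lspan_subspace E).1.
Qed.

Definition indep A Y : Prop := forall y, Y y -> ~ lspan (A `|` (Y `\ y)) y.

(** Zorn's lemma: in a maximal subset of [E] independent modulo [A], adding
another element [e] of [E] destroys independence, and the exchange argument puts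
[e] in the span. *)
Lemma exists_basis A E : exists Y, [/\ Y `<=` E, indep A Y &
  E `<=` lspan (A `|` Y)].
Proof.
pose P := [set Y : set V | Y `<=` E /\ indep A Y].
have [F FP Ftot|Y [[YE iY] maxY]] := @Zorn_bigcup _ P.
  split=> [x [X /FP [XE _]] /XE //|y [X0 FX0 X0y] sy].
  suff [X [FX X0X]] : exists X, [/\ F X, X0 `<=` X & lspan (A `|` (X `\ y)) y].
    by have [_ iX] := FP X FX; apply: iX; apply: X0X.
  move: sy; set W := [set v | exists X, [/\ F X, X0 `<=` X &
    lspan (A `|` (X `\ y)) v]].
  apply: (lspan_min (W := W)).
    split; first by exists X0; split=> //; apply: (lspan_subspace _).1.
    move=> a u v [X [FX X0X Xu]] [X' [FX' X0X' Xv]].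
    have mono Z Z' : Z `<=` Z' ->
        lspan (A `|` (Z `\ y)) `<=` lspan (A `|` (Z' `\ y)).
      move=> ZZ'; apply: lspan_mono => w [Aw|[Zw wy]]; first by left.
      by right; split=> //; exact: ZZ'.
    case: (Ftot X X' FX FX') => XX'.
      by exists X'; split=> //; apply: (lspan_subspace _).2 => //; apply: mono Xu.
    by exists X; split=> //; apply: (lspan_subspace _).2 => //; apply: mono Xv.
  move=> v [Av|[[X FX Xv] vy]].
    by exists X0; split=> //; apply: sub_lspan; left.
  case: (Ftot X0 X FX0 FX) => XX'.
    by exists X; split=> //; apply: sub_lspan; right; split.
  by exists X0; split=> //; apply: sub_lspan; right; split=> //; apply: XX'.
exists Y; split=> // e Ee; apply: contrapT => ne.
have nYe : ~ Y e by move=> Ye; apply: ne; apply: sub_lspan; right.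
apply: (maxY (Y `|` [set e])).
  by split=> [x Yx|sub]; [left | apply: nYe; apply: sub; right].
split=> [x [/YE //|-> //]|y Yy sy].
have [ye|ye] := pselect (y = e).
  apply: ne; rewrite -{1}ye; apply: lspan_mono sy => v [Av|[[Yv|->] vy]].
  - by left.
  - by right.
  - by case: vy; rewrite ye.
have {}Yy : Y y by case: Yy.
have sy' : lspan ((A `|` (Y `\ y)) `|` [set e]) y.
  apply: lspan_mono sy => v [Av|[[Yv|ve] vy]]; first by left; left.
    by left; right.
  by right.
have [a sa] := lspan_add1 sy'.
have [a0|a0] := eqVneq a 0.
  by move: sa; rewrite a0 scale0r subr0; apply: iY.
apply: ne; have -> : e = a^-1 *: (y - (y - a *: e)) by rewrite subKr scalerK.
have sAY : subspace (lspan (A `|` Y)) by exact: lspan_subspace.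
apply: (subspaceZ sAY); apply: (subspaceB sAY).
  by apply: sub_lspan; right.
by apply: lspan_mono sa => v [Av|[Yv _]]; [left | right].
Qed.

End Span.

(** Partial linear maps are treated as their graphs, subspaces of [V * M]. *)
Section Extension.
Variables V M : lmodType k.
Implicit Types (G : set (V * M)) (Y : set V).

Definition functional G : Prop := forall m, G (0, m) -> m = 0.

Definition dom G : set V := [set v | exists m, G (v, m)].

Definition graph Y (f : V -> M) : set (V * M) := [set p | Y p.1 /\ p.2 = f p.1].

Lemma dom_subspace G : subspace G -> subspace (dom G).
Proof.
move=> sG; split=> [|a x y [m Gx] [n Gy]]; first by exists 0; apply: sG.1.
by exists (a *: m + n); apply: (sG.2 a _ _ Gx Gy).
Qed.

Lemma dom_lspan G Y f v m :
  lspan (G `|` graph Y f) (v, m) -> lspan (dom G `|` Y) v.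
Proof.
apply: (lspan_min (W := [set p | lspan (dom G `|` Y) p.1])) => /=.
  by split=> [|a p q]; [apply: (lspan_subspace _).1 | apply: (lspan_subspace _).2].
move=> [u n] [Gu|[/= Yu _]]; apply: sub_lspan; last by right.
by left; exists n.
Qed.

(** Reduces the functionality of such a span to the case of finitely many
prescribed values, where induction applies. *)
Lemma graph_finite G Y f p : lspan (G `|` graph Y f) p ->
  exists2 s : seq V, (forall y, y \in s -> Y y) &
    lspan (G `|` graph [set` s] f) p.
Proof.
apply: (lspan_min (W := [set p | exists2 s : seq V, (forall y, y \in s -> Y y) &
    lspan (G `|` graph [set` s] f) p])).
  split; first by exists [::] => //; apply: (lspan_subspace _).1.
  move=> a u v [s sY su] [s' sY' sv]; exists (s ++ s') => [y|].
    by rewrite mem_cat => /orP[/sY|/sY'].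
  apply: (lspan_subspace _).2; [move: su | move: sv]; apply: lspan_mono => q;
    move=> [Gq|[qs qf]]; try (by left); right; split=> //=;
    by rewrite /= mem_cat qs ?orbT.
move=> [y m] [Gq|[/= Yy mf]].
  by exists [::] => //; apply: sub_lspan; left.
exists [:: y]; first by move=> z; rewrite inE => /eqP->.
by apply: sub_lspan; right; split=> //=; rewrite inE.
Qed.

(** By induction on the finite number of points [y] involved: a relation in which
the last [y] has a nonzero coefficient would put [y] in the span of the other
ones. *)
Lemma functional_lspan G Y f : subspace G -> functional G -> indep (dom G) Y ->
  functional (lspan (G `|` graph Y f)).
Proof.
move=> sG fG iY m /graph_finite[s sY].
elim: s sY m => [_ m|y s IH sY m].
  move=> H; apply: fG; move: H; apply: lspan_min => // p [//|[]].
  by rewrite /= in_nil.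
have {}IH := IH (fun z zs => sY z (@mem_behead _ (y :: s) z zs)).
have [ys|ys] := boolP (y \in s).
  move=> H; apply: IH; move: H; apply: lspan_mono => p [Gp|[ps pf]].
    by left.
  by right; split=> //; move: ps; rewrite /= inE => /orP[/eqP->|].
move=> H.
have /lspan_add1[a] : lspan ((G `|` graph [set` s] f) `|` [set (y, f y)]) (0, m).
  move: H; apply: lspan_mono => p [Gp|[ps pf]]; first by left; left.
  move: ps; rewrite /= inE => /orP[/eqP py|ps]; last by left; right.
  by right; case: p py pf => u n /= -> ->.
have -> : (0, m) - a *: (y, f y) = (- (a *: y), m - a *: f y) :> V * M.
  by congr (_, _); rewrite /= add0r.
have [->|a0 sa] := eqVneq a 0.
  by rewrite !scale0r oppr0 subr0; apply: IH.
have /dom_lspan sy := sa.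
case: (iY y); first by apply: sY; rewrite mem_head.
have {}sy := subspaceZ (lspan_subspace _) (- a^-1) sy.
move: sy; rewrite scaleNr scalerN opprK scalerK //.
apply: lspan_mono => v [Gv|vs]; [by left | right; split].
  by apply: sY; rewrite inE orbC (vs : is_true (v \in s)).
by move=> vy; move: ys; rewrite -vy (vs : is_true (v \in s)).
Qed.

End Extension.

(** Prescribe the value 0 on a basis modulo the domain. *)
Lemma linear_extension V M (G : set (V * M)) : subspace G -> functional G ->
  exists2 f : V -> M, linear f & forall v m, G (v, m) -> f v = m.
Proof.
move=> sG fG; have [Y [_ iY YT]] := exists_basis (dom G) [set: V].
have := functional_lspan (f := fun=> 0) sG fG iY.
set G' := lspan _ => fG'.
have sG' : subspace G' by exact: lspan_subspace.
have tot v : exists m, G' (v, m).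
  have : lspan (dom G `|` Y) v by apply: YT.
  apply: (lspan_min (W := dom G')) => [|u [[m Gu]|Yu]]; first exact: dom_subspace.
    by exists m; apply: sub_lspan; left.
  by exists 0; apply: sub_lspan; right.
have uniq v m n : G' (v, m) -> G' (v, n) -> m = n.
  move=> Gm Gn; apply: subr0_eq; apply: fG'.
  have := subspaceB sG' Gm Gn.
  by have -> : (v, m) - (v, n) = (0, m - n) :> V * M
    by congr (_, _); rewrite /= subrr.
exists (fun v => projT1 (cid (tot v))) => [a x y|v m Gv].
  case: (cid (tot x)) (cid (tot y)) (cid (tot _)) => m Gx [n Gy] [p Gp] /=.
  by apply: uniq Gp _; apply: (sG'.2 a _ _ Gx Gy).
case: (cid _) => n Gn /=; apply: uniq Gn _.
by apply: sub_lspan; left.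
Qed.

Lemma linear_extension_indep V M (A Y : set V) (g f : V -> M) :
    subspace A -> indep A Y -> linear g ->
  exists2 h : V -> M, linear h & {in A, h =1 g} /\ {in Y, h =1 f}.
Proof.
move=> sA iY lg; pose G := graph A g.
have sG : subspace G.
  split=> [|a [x m] [y n] [/= Ax ->] [/= Ay ->]]; split=> /=.
  - exact: sA.1.
  - by rewrite (lf0 lg).
  - exact: sA.2.
  - by rewrite lg.
have fG : functional G by move=> m [/= _ ->]; exact: lf0.
have domG : dom G = A.
  by apply/seteqP; split=> [v [m [Av _]]|v Av] //; exists (g v).
have fG' : functional (lspan (G `|` graph Y f)).
  by apply: functional_lspan; rewrite ?domG.
have [h lh hG] := linear_extension (lspan_subspace _) fG'.
exists h => //; split=> v /set_mem ?; apply: hG; apply: sub_lspan;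
  by [left; split | right; split].
Qed.

Lemma projection V (A : set V) : subspace A ->
  exists2 h : V -> V, linear h & (forall v, A (h v)) /\ (forall v, A v -> h v = v).
Proof.
move=> sA; have [Y [_ iY YT]] := exists_basis A [set: V].
have lid : linear (@id V) by [].
have [h lh [hA hY]] := linear_extension_indep (fun=> 0) sA iY lid.
exists h => //; split=> v; last by move=> Av; apply: hA; apply: mem_set.
have : lspan (A `|` Y) v by apply: YT.
apply: (lspan_min (W := [set v | A (h v)])).
  split=> [|a x y Ax Ay] /=; first by rewrite (lf0 lh); exact: sA.1.
  by rewrite lh; apply: sA.2.
move=> u [Au|Yu] /=; first by rewrite hA // mem_set.
by rewrite hY ?mem_set //; exact: sA.1.
Qed.

End Forms.

(** * Polarization, and the algebra of sequences *)

Section Polarization.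
Variables (k : fieldType) (char0 : [pchar k] =i pred0).
Variables (U M : lmodType k) (t : U -> U -> U -> M).
Hypotheses (lt : trilin t) (t0 : forall x, t x x x = 0).

Lemma natr_neq0 n : n.+1%:R != 0 :> k.
Proof. by move/pcharf0P: char0 => ->. Qed.

Lemma scaler_nat_eq0 n (m : M) : m *+ n.+1 = 0 -> m = 0.
Proof.
rewrite -scaler_nat => /eqP; rewrite scaler_eq0 (negPf (natr_neq0 n)).
by move/eqP.
Qed.

Lemma tlDl x x' y z : t (x + x') y z = t x y z + t x' y z.
Proof. exact: (lfD (lt.1 y z)). Qed.
Lemma tlDm x y y' z : t x (y + y') z = t x y z + t x y' z.
Proof. exact: (blDl (lt.2 x)). Qed.
Lemma tlDr x y z z' : t x y (z + z') = t x y z + t x y z'.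
Proof. exact: (blDr (lt.2 x)). Qed.

(* The part of degree 2 in a and 1 in b of t at a + b. *)
Let e a b := t a a b + t a b a + t b a a.

Let e_anti a b : e a b + e b a = 0.
Proof.
rewrite -(t0 (a + b)) !(tlDl, tlDm, tlDr) !t0 add0r addr0 /e.
by rewrite !addrA [LHS](ACl (1*2*6*3*5*4)).
Qed.

Let e0 a b : e a b = 0.
Proof.
apply: (@scaler_nat_eq0 1).
have e2l : e (a + a) b = e a b *+ 4.
  rewrite /e !(tlDl, tlDm, tlDr) !mulrS mulr0n addr0 !addrA.
  by rewrite (ACl (1*5*9*2*6*10*3*7*11*4*8*12)).
have e2r : e b (a + a) = e b a *+ 2.
  by rewrite /e !(tlDl, tlDm, tlDr) mulr2n !addrA (ACl (1*3*5*2*4*6)).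
have := e_anti (a + a) b; rewrite e2l e2r.
rewrite -(addr0_eq (e_anti a b)).
by rewrite mulNrn -mulrnBr.
Qed.

(** Comparing the scalings [a] and [a + a] in the expansion of [t] at [a + b]
separates the two partial linearizations; the full one follows by expanding
once more. *)
Lemma polarization a b c :
  t a b c + t a c b + t b a c + t b c a + t c a b + t c b a = 0.
Proof.
have := e0 (a + b) c; rewrite /e !(tlDl, tlDm, tlDr).
have := e0 a c; have := e0 b c; rewrite /e => eb ea.
rewrite !addrA (ACl (1*5*9*(4*8*12)*(2*6*3*7*10*11))) /=.
by rewrite ea eb !add0r.
Qed.

End Polarization.

Section Convolution.
Variable M : zmodType.

Lemma sum_antidiagonal (f : nat -> nat -> M) m n : (m < n)%N ->
  \sum_(j < m.+1) f j (m - j)%N =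
  \sum_(i < n) \sum_(j < n) if (i + j == m)%N then f i j else 0.
Proof.
move=> mn; rewrite (big_ord_widen n (fun j => f j (m - j)%N) mn) big_mkcond /=.
apply: eq_bigr => i _; rewrite -big_mkcond /=; case: ifP => im.
  have lmn : (m - i < n)%N by apply: leq_ltn_trans mn; exact: leq_subr.
  rewrite (big_pred1 (Ordinal lmn)) // => j.
  by rewrite -[RHS]val_eqE /= -(eqn_add2l i j) subnKC.
rewrite big1 // => j /eqP ijm; move: im.
by rewrite -ijm ltnS leq_addr.
Qed.

(** The part of degree [d] of a trilinear expression in power series truncated at
degree [n]. *)
Definition sum3 n d (f : nat -> nat -> nat -> M) : M :=
  \sum_(i < n) \sum_(j < n) \sum_(l < n)
    if (i + (j + l) == d)%N then f i j l else 0.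

Lemma sum3D n d f g :
  sum3 n d (fun i j l => f i j l + g i j l) = sum3 n d f + sum3 n d g.
Proof.
rewrite -big_split; apply: eq_bigr => i _; rewrite -big_split.
apply: eq_bigr => j _; rewrite -big_split; apply: eq_bigr => l _ /=.
by case: ifP => //; rewrite addr0.
Qed.

Lemma sum3_swap12 n d f : sum3 n d (fun i j l => f j i l) = sum3 n d f.
Proof.
rewrite /sum3 exchange_big; apply: eq_bigr => i _; apply: eq_bigr => j _.
by apply: eq_bigr => l _; rewrite addnCA.
Qed.

Lemma sum3_swap23 n d f : sum3 n d (fun i j l => f i l j) = sum3 n d f.
Proof.
apply: eq_bigr => i _; rewrite exchange_big; apply: eq_bigr => j _.
by apply: eq_bigr => l _; rewrite (addnC l).
Qed.

Lemma sum3_symmetrize n d f : sum3 n d f *+ 6 =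
  sum3 n d (fun i j l => f i j l + f i l j + f j i l + f j l i + f l i j + f l j i).
Proof.
rewrite !sum3D (sum3_swap23 n d f) (sum3_swap12 n d f).
rewrite (sum3_swap23 n d (fun i j l => f j i l)) (sum3_swap12 n d f).
rewrite (sum3_swap12 n d (fun i j l => f i l j)) (sum3_swap23 n d f).
rewrite (sum3_swap12 n d (fun i j l => f l i j)).
rewrite (sum3_swap23 n d (fun i j l => f j i l)) (sum3_swap12 n d f).
by rewrite !mulrS mulr0n addr0 !addrA.
Qed.

End Convolution.

Section CubicForm.
Variables (k : fieldType) (char0 : [pchar k] =i pred0) (alpha : k).
Variable A : algebra k.

Definition cubic_form (x y z : A) : A := x ** (y ** z) + alpha *: ((y ** z) ** x).

Lemma cubic_form_trilin : trilin cubic_form.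
Proof.
rewrite /cubic_form; split=> [y z|x].
  move=> a u v; rewrite !linearPl !linearPr /= !scalerDr !scalerA !(mulrC a).
  by rewrite addrACA.
split=> y a u v; rewrite ?linearPl ?linearPr ?linearPl /= !scalerDr !scalerA;
  by rewrite !(mulrC a) addrACA.
Qed.

Hypothesis VA : cubic_variety alpha A.

(** The sum is unchanged when its term is replaced by the average over the six
permutations of the indices, which polarization shows to be zero. *)
Lemma sum3_cubic_form n d (f : nat -> A) :
  sum3 n d (fun i j l => cubic_form (f i) (f j) (f l)) = 0.
Proof.
apply: (scaler_nat_eq0 char0 (n := 5)); rewrite sum3_symmetrize.
rewrite /sum3 big1 // => i _; rewrite big1 // => j _; rewrite big1 // => l _.
by rewrite polarization // ?if_same //; exact: cubic_form_trilin.
Qed.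

(** The Cauchy product: sequences are formal power series with coefficients in
[A]. *)
Definition conv (f g : nat -> A) : nat -> A :=
  fun n => \sum_(i < n.+1) f i ** g (n - i)%N.

Lemma conv_bilin : bilin (conv : (nat -> A : lmodType k) -> _ -> _).
Proof.
split=> [g a f f'|f a g g']; apply/funext => n.
  rewrite -[RHS]/(a *: conv f g n + conv f' g n) /conv scaler_sumr -big_split.
  by apply: eq_bigr => i _ /=; rewrite -linearPl.
rewrite -[RHS]/(a *: conv f g n + conv f g' n) /conv scaler_sumr -big_split.
by apply: eq_bigr => i _ /=; rewrite -linearPr.
Qed.

Definition seq_algebra : algebra k := algebra_of conv_bilin.

Lemma seq_algebra_cubic : cubic_variety alpha seq_algebra.
Proof.
move=> f; apply/funext => n.
rewrite -[RHS](sum3_cubic_form n.+1 n f).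
transitivity (\sum_(i < n.+1) (f i ** conv f f (n - i)%N +
                               alpha *: (conv f f (n - i)%N ** f i))).
  rewrite big_split -scaler_sumr /=; congr (_ + _ *: _).
  rewrite {1}/amul /= /bilin_mul {1}/conv (reindex_inj rev_ord_inj) /=.
  by apply: eq_bigr => i _; rewrite subSS subKn // -ltnS.
apply: eq_bigr => i _.
have lni : (n - i < n.+1)%N by rewrite ltnS leq_subr.
rewrite /conv (sum_antidiagonal (fun j l => f j ** f l) lni).
rewrite (bl_sumr (mul_bilin A)) (bl_suml (mul_bilin A)) scaler_sumr -big_split.
apply: eq_bigr => j _.
rewrite (bl_sumr (mul_bilin A)) (bl_suml (mul_bilin A)) scaler_sumr -big_split.
apply: eq_bigr => l _ /=.
rewrite -(eqn_add2l i) subnKC; last by rewrite -ltnS.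
case: ifP => _ //.
by rewrite (bl0r (mul_bilin A)) (bl0l (mul_bilin A)) scaler0 addr0.
Qed.

End CubicForm.

(** * Consequences of the universal property *)

Section FreeAlgebra.
Variables (k : fieldType) (char0 : [pchar k] =i pred0) (alpha : k).
Variables (X : Type) (F : algebra k) (i : X -> F).
Hypothesis free_i : free_on (@cubic_variety k alpha) i.

Lemma free_hom_eq (B : algebra k) (g h : F -> B) : cubic_variety alpha B ->
  alg_hom g -> alg_hom h -> (forall x, g (i x) = h (i x)) -> g =1 h.
Proof.
move=> VB hg hh gh x; have [f _ uf] := free_i.2 B (fun x => h (i x)) VB.
by rewrite (uf g) // (uf h).
Qed.

(** A subalgebra lies in the variety, so a map from the generators into it
extends; by uniqueness, composing with the inclusion gives the identity. *)
Lemma free_ind (P : set F) : subspace P ->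
  (forall x y, P x -> P y -> P (x ** y)) -> (forall x, P (i x)) ->
  forall x, P x.
Proof.
move=> sP mP iP x.
pose S := @Subalgebra k F P sP.1 sP.2 mP.
have VS : cubic_variety alpha (subalg_algebra S).
  by move=> u; apply: val_inj; rewrite /= free_i.1.
pose j x : subalg_algebra S := Sub (i x) (mem_set (iP x)).
have [h [[lh mh] hj] _] := free_i.2 _ j VS.
have -> : x = val (h x).
  apply: (free_hom_eq (g := id) (h := fun x => val (h x))) => //.
  - exact: free_i.1.
  - split=> [a u v|u v]; first by rewrite lh.
    by rewrite mh.
  - by move=> y; rewrite hj.
exact/set_mem/valP.
Qed.

(** The product [(u, m) (v, n) = (u v, b u v)] on [F * M] satisfies the identity
exactly because [b] satisfies its cocycle form, and [l] is the second component of
the homomorphism sending each generator [i x] to [(i x, 0)]. *)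
Lemma free_cocycle (M : lmodType k) (b : F -> F -> M) : bilin b ->
    (forall x, b x (x ** x) + alpha *: b (x ** x) x = 0) ->
  exists2 l : F -> M, linear l & forall u v, l (u ** v) = b u v.
Proof.
move=> lb b0; pose m (p q : F * M) : F * M := (p.1 ** q.1, b p.1 q.1).
have lm : bilin m.
  split=> [q a p p'|p a q q'] /=.
    by congr (_, _); rewrite /= ?linearPl // blPl.
  by congr (_, _); rewrite /= ?linearPr // blPr.
have VM : cubic_variety alpha (algebra_of lm).
  by move=> p; congr (_, _); rewrite /= ?free_i.1 ?b0.
have [h [[lh mh] hi] _] := free_i.2 (algebra_of lm) (fun x => (i x, 0)) VM.
have h1 x : (h x).1 = x.
  apply: (free_hom_eq (g := fun x => (h x).1) (h := id)) => //.
  - exact: free_i.1.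
  - by split=> [a u v|u v]; rewrite ?lh ?mh.
  - by move=> y; rewrite hi.
exists (fun x => (h x).2) => [a u v|u v]; first by rewrite lh.
by rewrite mh /= !h1.
Qed.

End FreeAlgebra.

(** A grading by positive degrees, given by the projections onto its
components. *)
Record grading (k : fieldType) (F : algebra k) := Grading {
  gp :> nat -> F -> F;
  gp_linear : forall n, linear (gp n);
  gp_gp : forall m n x, gp m (gp n x) = if m == n then gp n x else 0;
  gp0 : forall x, gp 0%N x = 0;
  gpM : forall n x y, gp n (x ** y) = \sum_(i < n.+1) gp i x ** gp (n - i)%N y;
  gp_fin : forall x, exists n, x = \sum_(i < n) gp i x
}.

Section FreeGrading.
Variables (k : fieldType) (char0 : [pchar k] =i pred0) (alpha : k).
Variables (X : Type) (F : algebra k) (i : X -> F).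
Hypothesis free_i : free_on (@cubic_variety k alpha) i.

(** The homomorphism to power series which sends each generator [i x] to [i x]
times the indeterminate sends an element to the series of its homogeneous
components. *)
Lemma free_grading : inhabited (grading F).
Proof.
have VS := seq_algebra_cubic char0 free_i.1.
pose j x : seq_algebra F := fun n => if n == 1%N then i x else 0.
have [h [[lh mh] hi] _] := free_i.2 _ j VS.
have lp n : linear (h^~ n) by move=> a x y; rewrite lh.
have pM n x y : h (x ** y) n = \sum_(l < n.+1) h x l ** h y (n - l)%N.
  by rewrite mh.
pose hom n x := forall m, h x m = if m == n then x else 0.
have homM a b x y : hom a x -> hom b y -> hom (a + b)%N (x ** y).
  move=> hx hy m; rewrite pM.
  have [->|mab] := eqVneq m (a + b)%N.
    have lab : (a < (a + b).+1)%N by rewrite ltnS leq_addr.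
    rewrite (bigD1 (Ordinal lab)) //= hx eqxx hy addKn eqxx big1 ?addr0 // => l la.
    by rewrite hx -[_ == a]/(l == Ordinal lab) (negPf la) (bl0l (mul_bilin F)).
  rewrite big1 // => l _; rewrite hx; case: eqP => [la|_]; last first.
    by rewrite (bl0l (mul_bilin F)).
  rewrite hy; case: eqP => [lb|_]; last by rewrite (bl0r (mul_bilin F)).
  by move: mab; rewrite -la -lb subnKC ?eqxx // -ltnS.
(* The axioms of a grading are immediate on homogeneous elements, and these span
   F since their span is a subalgebra. *)
pose W := lspan [set x | exists2 n, (0 < n)%N & hom n x].
have sW : subspace W by exact: lspan_subspace.
have WM x y : W x -> W y -> W (x ** y).
  move=> Wx; move: y; apply: {Wx}(Wx [set x | forall y, W y -> W (x ** y)]).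
    split=> [y _|a u v Wu Wv y Wy].
      by rewrite (bl0l (mul_bilin F)); exact: sW.1.
    by rewrite linearPl; apply: sW.2; [apply: Wu | apply: Wv].
  move=> {}x [m m0 hx] y Wy; apply: {Wy}(Wy [set y | W (x ** y)]).
    split=> [|a u v Wu Wv] /=.
      by rewrite (bl0r (mul_bilin F)); exact: sW.1.
    by rewrite linearPr; apply: sW.2.
  move=> {}y [n n0 hy]; apply: sub_lspan; exists (m + n)%N; last exact: homM.
  by rewrite addn_gt0 m0.
have Wall x : W x.
  apply: (free_ind free_i sW WM) => y; apply: sub_lspan; exists 1%N => // m.
  by rewrite hi.
have pp m n x : h (h x n) m = if m == n then h x n else 0.
  move: m n; apply: (Wall x [set x | forall m n,
    h (h x n) m = if m == n then h x n else 0]).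
    split=> [m n|a u v Wu Wv m n] /=.
      by rewrite !(lf0 (lp _)) if_same.
    rewrite !lp Wu Wv; case: eqP => // _; by rewrite scaler0 addr0.
  move=> {}x [d _ hx] m n; rewrite !hx.
  have [->|nd] := eqVneq n d; first exact: hx.
  by rewrite (lf0 (lp m)) if_same.
have p0 x : h x 0%N = 0.
  apply: (Wall x [set x | h x 0%N = 0]).
    split=> [|a u v Wu Wv] /=; first exact: (lf0 (lp _)).
    by rewrite lp Wu Wv scaler0 addr0.
  by move=> {}x [n n0 hx] /=; rewrite hx; case: n n0 {hx}.
have pfin x : exists n, x = \sum_(l < n) h x l.
  suff [n Hn] : exists n, forall m, (n <= m)%N -> x = \sum_(l < m) h x l.
    by exists n; apply: Hn.
  apply: (Wall x [set x | exists n, forall m, (n <= m)%N ->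
    x = \sum_(l < m) h x l]).
    split=> [|a u v [m Hm] [n Hn]] /=.
      by exists 0%N => m _; rewrite big1 // => l _; exact: (lf0 (lp _)).
    exists (maxn m n) => d; rewrite geq_max => /andP[md nd].
    rewrite {1}(Hm _ md) {1}(Hn _ nd) scaler_sumr -big_split.
    by apply: eq_bigr => l _; rewrite lp.
  move=> {}x [n n0 hx]; exists n.+1 => m nm.
  rewrite (bigD1 (Ordinal nm)) //= hx eqxx big1 ?addr0 // => l ln.
  by rewrite hx -[_ == n]/(l == Ordinal nm) (negPf ln).
exact: inhabits (Grading lp pp p0 pM pfin).
Qed.

End FreeGrading.

(** * Graded algebras and their subalgebras *)

Section HomSpace.
Variables (k : fieldType) (U M : lmodType k).

(** The vector space of linear maps, which allows a family of linear maps
depending linearly on a parameter to be treated as one linear map. *)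
Definition lin_pred : {pred U -> M} := fun f => `[< linear f >].

Fact lin_submod_closed : submod_closed lin_pred.
Proof.
split=> [|a f g /asboolP lf /asboolP lg]; apply/asboolP=> c x y.
  by rewrite /= scaler0 addr0.
rewrite -[LHS]/(a *: f _ + g _) -[RHS]/(c *: (a *: f x + g x) + (a *: f y + g y)).
by rewrite lf lg !scalerDr !scalerA (mulrC a) addrACA.
Qed.

HB.instance Definition _ :=
  GRing.isSubmodClosed.Build k (U -> M) lin_pred lin_submod_closed.

Definition hom_space := {f : U -> M | lin_pred f}.
HB.instance Definition _ := [isSub of hom_space for @sval (U -> M) lin_pred].
HB.instance Definition _ := [Choice of hom_space by <:].
HB.instance Definition _ := [SubChoice_isSubLmodule of hom_space by <:].

Definition to_hom (f : U -> M) (lf : linear f) : hom_space :=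
  Sub f (introT (asboolP _) lf).

Lemma hom_linear (f : hom_space) : linear (val f).
Proof. exact/asboolP/(valP f). Qed.

Lemma hom_valP a (f g : hom_space) x :
  val (a *: f + g) x = a *: val f x + val g x.
Proof. by []. Qed.

End HomSpace.

Section LinearClosure.
Variable k : fieldType.
Implicit Types U V M : lmodType k.

Lemma linD U M (f g : U -> M) : linear f -> linear g ->
  linear (fun x => f x + g x).
Proof. by move=> lf lg a x y; rewrite lf lg scalerDr addrACA. Qed.

Lemma linZ U M c (f : U -> M) : linear f -> linear (fun x => c *: f x).
Proof. by move=> lf a x y; rewrite lf scalerDr !scalerA mulrC. Qed.

Lemma linB U M (f g : U -> M) : linear f -> linear g ->
  linear (fun x => f x - g x).
Proof.
by move=> lf lg a x y; rewrite lf lg opprD addrACA scalerBr.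
Qed.

Lemma lin_comp U V M (f : V -> M) (g : U -> V) : linear f -> linear g ->
  linear (fun x => f (g x)).
Proof. by move=> lf lg a x y; rewrite lg lf. Qed.

Lemma linS U M n (f : nat -> U -> M) : (forall i, linear (f i)) ->
  linear (fun x => \sum_(i < n) f i x).
Proof.
move=> lf a x y; rewrite scaler_sumr -big_split.
by apply: eq_bigr => i _; rewrite lf.
Qed.

End LinearClosure.

Section Graded.
Variables (k : fieldType) (F : algebra k) (p : grading F).

Let lp := gp_linear p.
Let lM := mul_bilin F.

Definition graded_sub (G : set F) : Prop :=
  [/\ subspace G, forall x y, G x -> G y -> G (x ** y) &
      forall n x, G x -> G (p n x)].

Definition degree_le (M : lmodType k) n (b : F -> F -> M) : Prop :=
  forall i j x y, (n < i + j)%N -> b (p i x) (p j y) = 0.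

Definition trunc n x := \sum_(i < n.+1) p i x.

Lemma gp_eq (M : lmodType k) (f g : F -> M) : linear f -> linear g ->
  (forall i x, f (p i x) = g (p i x)) -> f =1 g.
Proof.
move=> lf lg fg x; have [n ->] := gp_fin p x.
by rewrite (lf_sum lf) (lf_sum lg); apply: eq_bigr => i _.
Qed.

Lemma gpMM n a b x y :
  p n (p a x ** p b y) = if n == (a + b)%N then p a x ** p b y else 0.
Proof.
rewrite gpM; case: eqP => [->|nab].
  have lab : (a < (a + b).+1)%N by rewrite ltnS leq_addr.
  rewrite (bigD1 (Ordinal lab)) //= gp_gp eqxx addKn gp_gp eqxx.
  rewrite big1 ?addr0 // => l la.
  by rewrite gp_gp -[_ == a]/(l == Ordinal lab) (negPf la) (bl0l lM).
rewrite big1 // => l _; rewrite gp_gp; case: eqP => [la|_]; last exact: bl0l.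
rewrite gp_gp; case: eqP => [lb|_]; last exact: bl0r.
by case: nab; rewrite -la -lb subnKC // -ltnS.
Qed.

Lemma gp_bound x : exists n, forall m, (n <= m)%N -> p m x = 0.
Proof.
have [n nx] := gp_fin p x; exists n => m nm; rewrite nx (lf_sum (lp m)).
rewrite big1 // => i _; rewrite gp_gp; case: eqP => // mi.
by move: nm; rewrite mi leqNgt ltn_ord.
Qed.

Lemma trunc_linear n : linear (trunc n).
Proof. exact: linS. Qed.

Lemma trunc_gp n a x : trunc n (p a x) = if (a <= n)%N then p a x else 0.
Proof.
rewrite /trunc; case: leqP => an.
  rewrite (bigD1 (Ordinal (an : a < n.+1)%N)) //= gp_gp eqxx.
  rewrite big1 ?addr0 // => i ia.
  by rewrite gp_gp -[_ == a]/(i == Ordinal (an : a < n.+1)%N) (negPf ia).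
rewrite big1 // => i _; rewrite gp_gp; case: eqP => // ia.
by move: an; rewrite -ia leqNgt ltn_ord.
Qed.

Lemma truncK (M : lmodType k) n (f : F -> M) : linear f ->
  (forall m x, (n < m)%N -> f (p m x) = 0) -> forall x, f (trunc n x) = f x.
Proof.
move=> lf f0; apply: gp_eq => // [|i x]; first exact: lin_comp lf (trunc_linear n).
by rewrite trunc_gp; case: leqP => // /f0->; rewrite (lf0 lf).
Qed.

End Graded.

(** * Integrating cocycles defined on a graded subalgebra *)

Section Core.
Variables (k : fieldType) (char0 : [pchar k] =i pred0).
Variables (alpha : k) (alpha_neq1 : alpha <> 1).
Variables (F : algebra k) (p : grading F).

Definition cocycle_on (G : set F) (M : lmodType k) (b : F -> F -> M) : Prop :=
  forall x, G x -> b x (x ** x) + alpha *: b (x ** x) x = 0.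

Hypothesis cocycle_integral : forall (M : lmodType k) (b : F -> F -> M),
  bilin b -> cocycle_on setT b ->
  exists2 l : F -> M, linear l & forall u v, l (u ** v) = b u v.

Let lp := gp_linear p.
Let lM := mul_bilin F.

(** The second condition, on the whole of [F], is what makes the case of
[G] = 0 useful: every bilinear map is a cocycle on 0, so it says that a symmetric
bilinear map of bounded degree is a linear function of the commutative product
[u v + v u]. *)
Definition integrable n : Prop :=
  forall (M : lmodType k) (b : F -> F -> M) (G : set F),
    bilin b -> degree_le p n b -> graded_sub p G -> cocycle_on G b ->
  exists2 l : F -> M, linear l &
    (forall u v, G u -> G v -> l (u ** v) = b u v) /\
    (forall u v, l (u ** v + v ** u) = b u v + b v u).

Lemma graded_sub0 : graded_sub p [set 0].
Proof.
split=> [|x y -> ->|n x ->] /=; last exact: (lf0 (lp n)).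
  by split=> // a x y /= -> ->; rewrite scaler0 addr0.
by rewrite (bl0l lM).
Qed.

(** Apply integrability on 0 to half of [q], then truncate the resulting linear
map so that its degree is bounded as well. *)
Lemma symmetric_integral n (M : lmodType k) (q : F -> F -> M) :
    integrable n -> bilin q -> degree_le p n q ->
    (forall x y, q x y = q y x) ->
  exists2 l : F -> M, linear l &
    (forall u v, l (u ** v + v ** u) = q u v) /\
    (forall m x, (n < m)%N -> l (p m x) = 0).
Proof.
move=> In lq dq sq.
have := In M (fun x y => 2^-1 *: q x y) [set 0].
case=> [||||l ll [_ lE]].
- by split=> [y|x]; apply: linZ; [exact: (lq.1 y) | exact: (lq.2 x)].
- by move=> i j x y ij; rewrite dq // scaler0.
- exact: graded_sub0.
- by move=> x ->; rewrite (bl0r lM) (bl0r lq) !scaler0 addr0.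
exists (fun x => l (trunc p n x)) => [|]; first exact: lin_comp (trunc_linear p n).
split=> [u v|m x nm]; last by rewrite trunc_gp leqNgt nm (lf0 ll).
have half : 2^-1 + 2^-1 = 1 :> k.
  by rewrite -(mulr2n 2^-1) -[_ *+ _]mulr_natr mulVf //; exact: natr_neq0.
have {}lE u' v' : l (u' ** v' + v' ** u') = q u' v'.
  by rewrite lE (sq v') -scalerDl half scale1r.
have trE : forall i x j y,
    l (trunc p n (p i x ** p j y + p j y ** p i x)) = q (p i x) (p j y).
  move=> i x j y; rewrite (lfD (trunc_linear p n)).
  have tr a b w z : trunc p n (p a w ** p b z) =
      if (a + b <= n)%N then p a w ** p b z else 0.
    have -> : p a w ** p b z = p (a + b)%N (p a w ** p b z) by rewrite gpMM eqxx.
    by rewrite trunc_gp.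
  rewrite !tr (addnC j); case: leqP => [_|/dq ->]; first exact: lE.
  by rewrite addr0 (lf0 ll).
have ltr : linear (fun x => l (trunc p n x)) by exact: lin_comp (trunc_linear p n).
have lin_sym w : linear (fun x => l (trunc p n (x ** w + w ** x))).
  by apply: (lin_comp ltr); apply: linD; [exact: (lM.1 w) | exact: (lM.2 w)].
move: u; apply: gp_eq => [||i x]; [exact: lin_sym | exact: (lq.1 v) |].
have := @gp_eq k F p M (fun v => l (trunc p n (p i x ** v + v ** p i x))) (q (p i x)).
apply; last by move=> j y; exact: trE.
  by move=> a y z; rewrite ![p i x ** _ + _]addrC; exact: lin_sym.
exact: (lq.2 _).
Qed.

Definition degree3_le (M : lmodType k) n (t : F -> F -> F -> M) : Prop :=
  forall a b c x y z, (n < a + b + c)%N -> t (p a x) (p b y) (p c z) = 0.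

(** The sum of [G] and of the components of degree at least [m], for a graded
[G]. *)
Definition above (G : set F) m : set F :=
  [set x | forall i, (i < m)%N -> G (p i x)].

(** The projection onto a complement of the degree [m] part of [G] in the degree
[m] part of [F]. *)
Lemma graded_complement G m : graded_sub p G -> exists2 r : F -> F, linear r &
  [/\ forall x, G (p m x) -> r x = 0,
      forall x, r (r x) = r x,
      forall a x, r (p a x) = if a == m then r x else 0,
      forall a x, p a (r x) = if a == m then r x else 0 &
      forall x, G (p m x - r x)].
Proof.
move=> [sG mG pG]; have [h lh [Gh hK]] := projection sG.
exists (fun x => p m x - p m (h (p m x))).
  apply: linB => //; apply: (lin_comp (lp m)); exact: lin_comp (lp m).
have pr x : p m (p m x - p m (h (p m x))) = p m x - p m (h (p m x)).
  by rewrite (lfB (lp m)) !gp_gp eqxx.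
split=> [x Gx|x|a x|a x|x].
- by rewrite hK // gp_gp eqxx subrr.
- rewrite pr (lfB lh) (lfB (lp m)) (hK (p m (h _))); last exact/pG/Gh.
  by rewrite gp_gp eqxx subrr subr0.
- rewrite gp_gp eq_sym; case: eqP => [->//|_].
  by rewrite (lf0 lh) (lf0 (lp m)) subrr.
- by rewrite -pr gp_gp pr.
- by rewrite subKr; exact/pG/Gh.
Qed.

(** With [r] the projection onto a complement in degree [m] and [s x = x - r x],
the vector [s x] lies in [above G m.+1] for [x] in [above G m], so [t] vanishes at
[s x]. The telescoping sum
[t x x x - t s s s = t r x x + t s r x + t s s r] then exhibits [t x x x] as
[psi (r x) x x]. Integrating the symmetrization of [psi u] along [y z + z y], for
all [u] at once, gives [l], and [d x w] pairs [w] with [r x] through [l],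
antisymmetrized. The antisymmetrizing term does not contribute at [w = x x],
because [x x] lies in [above G m.+1], where [r] vanishes. *)
Lemma cubic_step n m (M : lmodType k) (t : F -> F -> F -> M) (G : set F) :
    (0 < m <= n)%N -> integrable (n - m) -> trilin t -> degree3_le n t ->
    graded_sub p G -> (forall x, above G m.+1 x -> t x x x = 0) ->
  exists2 d : F -> F -> M, bilin d &
    [/\ forall x y, d x y = - d y x, forall x y, G x -> G y -> d x y = 0,
        degree_le p n d & forall x, above G m x -> d x (x ** x) = t x x x].
Proof.
move=> /andP[m0 mn] In lt dt gG t0.
have [r lr [rG rr rp pr Gr]] := graded_complement m gG.
have [sG mG pG] := gG.
pose s x := x - r x.
have ls : linear s by apply: linB.
have sp a x : p a (s (p a x)) = s (p a x).
  rewrite /s (lfB (lp a)) gp_gp eqxx rp; case: eqP => [->|_]; last first.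
    by rewrite (lf0 (lp a)).
  by rewrite pr eqxx.
pose psi u y z := t u y z + t (s y) u z + t (s y) (s z) u.
have lpsi : trilin psi.
  split=> [y z|u].
    apply: linD; [apply: linD|].
    - exact: (lt.1 y z).
    - exact: ((lt.2 (s y)).1 z).
    - exact: ((lt.2 (s y)).2 (s z)).
  split=> [z|y]; (apply: linD; [apply: linD|]).
  - exact: ((lt.2 u).1 z).
  - exact: lin_comp (lt.1 u z) ls.
  - exact: lin_comp (lt.1 (s z) u) ls.
  - exact: ((lt.2 u).2 y).
  - exact: ((lt.2 (s y)).2 u).
  - exact: lin_comp ((lt.2 (s y)).1 u) ls.
have lq y z : linear (fun u => psi (r u) y z + psi (r u) z y).
  by apply: linD; [exact: lin_comp (lpsi.1 y z) lr | exact: lin_comp (lpsi.1 z y) lr].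
pose q y z : hom_space F M := to_hom (lq y z).
have bq : bilin q.
  have sym y z : q y z = q z y.
    by apply: val_inj; apply/funext => u; rewrite /= addrC.
  have l1 z : linear (q^~ z).
    move=> a y y'; apply: val_inj; apply/funext => u.
    rewrite hom_valP /= (blPl (lpsi.2 _)) (blPr (lpsi.2 _)).
    by rewrite addrACA -scalerDr.
  by split=> // y a z z'; rewrite !(sym y); exact: l1.
have dq : degree_le p (n - m) q.
  have psi0 a c x y u : (n - m < a + c)%N -> psi (r u) (p a x) (p c y) = 0.
    move=> ac; have -> : r u = p m (r u) by rewrite pr eqxx.
    have nac : (n < m + a + c)%N by rewrite -addnA -ltn_subLR.
    rewrite /psi -(sp a x) -(sp c y) !dt ?addr0 //; last by rewrite (addnC a).
    by rewrite addnC addnA.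
  move=> a c x y ac; apply: val_inj; apply/funext => u /=.
  by rewrite !psi0 ?addr0 // addnC.
have sq x y : q x y = q y x by apply: val_inj; apply/funext => u; rewrite /= addrC.
have [l ll [lE dl]] := symmetric_integral In bq dq sq.
exists (fun x w => val (l w) (r x) - val (l x) (r w)).
  have lval u : linear (fun w => val (l w) u) by move=> a w w'; rewrite ll.
  split=> [w|x]; apply: linB.
  - exact: lin_comp (hom_linear _) lr.
  - exact: lval.
  - exact: lval.
  - exact: lin_comp (hom_linear _) lr.
split=> [x y|x y Gx Gy|a c x w nac|x Hx].
- by rewrite opprB.
- by rewrite !rG ?(lf0 (hom_linear _)) ?subrr //; exact: pG.
- have half b e u v : (n < b + e)%N -> val (l (p e v)) (r (p b u)) = 0.
    rewrite rp; case: eqP => [->|_ _]; last exact: (lf0 (hom_linear _)).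
    by rewrite -ltn_subLR // => /dl->.
  by rewrite !half ?subrr // addnC.
have Gxx : G (p m (x ** x)).
  rewrite gpM; apply: (subspace_sum sG) => i _.
  have [i0|i0] := posnP i; first by rewrite i0 gp0 (bl0l lM); exact: sG.1.
  have [im|im] := eqVneq (i : nat) m.
    by rewrite im subnn gp0 (bl0r lM); exact: sG.1.
  apply: mG; apply: Hx; first by rewrite ltn_neqAle im -ltnS ltn_ord.
  by rewrite ltn_subrL i0 m0.
rewrite (rG _ Gxx) (lf0 (hom_linear _)) subr0.
have -> : val (l (x ** x)) (r x) = psi (r x) x x.
  apply/subr0_eq/(scaler_nat_eq0 char0 (n := 1)).
  rewrite mulrnBl mulr2n.
  have -> : val (l (x ** x)) (r x) + val (l (x ** x)) (r x) =
      val (l (x ** x + x ** x)) (r x) by rewrite (lfD ll).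
  by rewrite lE /= rr -mulr2n subrr.
have : t (s x) (s x) (s x) = 0.
  apply: t0 => i; rewrite ltnS leq_eqVlt => /orP[/eqP->|im].
    by rewrite (lfB (lp m)) pr eqxx; exact: Gr.
  by rewrite (lfB (lp i)) pr (ltn_eqF im) subr0; exact: Hx.
have e1 : t x x x = t (r x) x x + t (s x) x x.
  by rewrite -(tlDl lt) addrC subrK.
have e2 : t (s x) x x = t (s x) (r x) x + t (s x) (s x) x.
  by rewrite -(tlDm lt) addrC subrK.
have e3 : t (s x) (s x) x = t (s x) (s x) (r x) + t (s x) (s x) (s x).
  by rewrite -(tlDr lt) addrC subrK.
by rewrite e1 e2 e3 => ->; rewrite addr0 /psi !addrA.
Qed.

(** Since [t] has degree at most [n], it vanishes on [above G n.+1]; descending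
from there, each step makes the remaining form vanish on [above G m] for a smaller
[m], and [above G 1] is everything. *)
Lemma cubic_integral n (M : lmodType k) (t : F -> F -> F -> M) (G : set F) :
    (forall m, (m < n)%N -> integrable m) -> trilin t -> degree3_le n t ->
    graded_sub p G -> (forall x, G x -> t x x x = 0) ->
  exists2 d : F -> F -> M, bilin d &
    [/\ forall x y, d x y = - d y x, forall x y, G x -> G y -> d x y = 0 &
        forall x, d x (x ** x) = t x x x].
Proof.
move=> In lt dt gG t0; have [sG mG pG] := gG.
suff: forall m, (m <= n)%N -> forall t : F -> F -> F -> M,
    trilin t -> degree3_le n t -> (forall x, above G m.+1 x -> t x x x = 0) ->
  exists2 d : F -> F -> M, bilin d &
    [/\ forall x y, d x y = - d y x, forall x y, G x -> G y -> d x y = 0 &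
        forall x, d x (x ** x) = t x x x].
  move=> /(_ n (leqnn n) t lt dt); apply=> x Hx.
  (* A form of degree at most n does not see the components of degree above n. *)
  have dt1 a x' y z : (n < a)%N -> t (p a x') y z = 0.
    move=> na; move: y.
    apply: (gp_eq (p := p) (g := fun=> 0)) => [||b y].
    - exact: ((lt.2 _).1 _).
    - by move=> c u v; rewrite scaler0 addr0.
    move: z; apply: (gp_eq (p := p) (g := fun=> 0)) => [||c z].
    - exact: ((lt.2 _).2 _).
    - by move=> c u v; rewrite scaler0 addr0.
    by apply: dt; rewrite -addnA ltn_addr.
  have dt2 a x' y z : (n < a)%N -> t x' (p a y) z = 0.
    move=> na; move: x'.
    apply: (gp_eq (p := p) (g := fun=> 0)) => [||b y'].
    - exact: (lt.1 _ _).
    - by move=> c u v; rewrite scaler0 addr0.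
    move: z; apply: (gp_eq (p := p) (g := fun=> 0)) => [||c z].
    - exact: ((lt.2 _).2 _).
    - by move=> c u v; rewrite scaler0 addr0.
    by apply: dt; rewrite addnAC ltn_addl.
  have dt3 a x' y z : (n < a)%N -> t x' y (p a z) = 0.
    move=> na; move: x'.
    apply: (gp_eq (p := p) (g := fun=> 0)) => [||b x'].
    - exact: (lt.1 _ _).
    - by move=> c u v; rewrite scaler0 addr0.
    move: y; apply: (gp_eq (p := p) (g := fun=> 0)) => [||c y].
    - exact: ((lt.2 _).1 _).
    - by move=> c u v; rewrite scaler0 addr0.
    by apply: dt; rewrite ltn_addl.
  rewrite -(truncK (p := p) (n := n) (lt.1 x x)); last by move=> *; exact: dt1.
  rewrite -(truncK (p := p) (n := n) ((lt.2 _).1 x)); last by move=> *; exact: dt2.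
  rewrite -(truncK (p := p) (n := n) ((lt.2 _).2 _)); last by move=> *; exact: dt3.
  by apply: t0; apply: (subspace_sum sG) => i _; exact: Hx.
elim=> [|m IH] mn {lt dt t0}t lt dt t0.
  exists (fun _ _ => 0).
    by split=> _ a x y; rewrite scaler0 addr0.
  split=> // [_ _|x]; first by rewrite oppr0.
  by rewrite t0 // => -[|//] _; rewrite gp0; exact: sG.1.
have [|d ld [ad Gd dd dE]] := cubic_step (m := m.+1) mn _ lt dt gG t0.
  by apply: In; rewrite ltn_subrL; case: (n) mn.
pose t' x y z := t x y z - d x (y ** z).
have [||x Hx|d' ld' [ad' Gd' dE']] := IH (ltnW mn) t'.
- split=> [y z|x]; first by apply: linB; [exact: lt.1 | exact: ld.1].
  split=> [z|y]; apply: linB.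
  + exact: ((lt.2 x).1 z).
  + exact: lin_comp (ld.2 x) (lM.1 z).
  + exact: ((lt.2 x).2 y).
  + exact: lin_comp (ld.2 x) (lM.2 y).
- move=> a b c x y z nabc; rewrite /t' dt //.
  have -> : p b y ** p c z = p (b + c)%N (p b y ** p c z) by rewrite gpMM eqxx.
  by rewrite dd ?subrr // addnA.
- by rewrite /t' dE // subrr.
exists (fun x y => d x y + d' x y).
  by split=> [y|x]; apply: linD; [exact: ld.1|exact: ld'.1|exact: ld.2|exact: ld'.2].
split=> [x y|x y Gx Gy|x].
- by rewrite ad ad' opprD.
- by rewrite Gd // Gd' // addr0.
- by rewrite dE' addrC subrK.
Qed.

(** An alternating [d] contributes [(1 - alpha) d x (x x)] to the cocycle
condition, so dividing by [1 - alpha] turns the defect of [b] into a form realized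
by [cubic_integral]. The correction [d] vanishes on [G] and disappears from
[b u v + b v u]. *)
Lemma all_integrable n : integrable n.
Proof.
elim/ltn_ind: n => n In M b G lb db gG cb.
have a1 : 1 - alpha != 0 by rewrite subr_eq0 eq_sym; apply/eqP.
pose t x y z := - (1 - alpha)^-1 *: (b x (y ** z) + alpha *: b (y ** z) x).
have lt : trilin t.
  split=> [y z|x].
    apply: linZ; apply: linD; first exact: lb.1.
    by apply: linZ; exact: lb.2.
  split=> [z|y]; (apply: linZ; apply: linD; last apply: linZ).
  - exact: lin_comp (lb.2 x) (lM.1 z).
  - exact: lin_comp (lb.1 x) (lM.1 z).
  - exact: lin_comp (lb.2 x) (lM.2 y).
  - exact: lin_comp (lb.1 x) (lM.2 y).
have dt : degree3_le n t.
  move=> a c e x y z nace; rewrite /t.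
  have -> : p c y ** p e z = p (c + e)%N (p c y ** p e z) by rewrite gpMM eqxx.
  by rewrite !db ?scaler0 ?addr0 ?scaler0 // ?addnA // addnC addnA.
have t0 x : G x -> t x x x = 0 by move=> Gx; rewrite /t cb // scaler0.
have [d ld [ad Gd dE]] := cubic_integral In lt dt gG t0.
have [||l ll lE] := cocycle_integral (b := fun x y => b x y + d x y).
- by split=> [y|x]; apply: linD; [exact: lb.1|exact: ld.1|exact: lb.2|exact: ld.2].
- move=> x _; rewrite scalerDr (ad (x ** x)) scalerN addrACA.
  have -> : d x (x ** x) - alpha *: d x (x ** x) = (1 - alpha) *: t x x x.
    by rewrite dE scalerBl scale1r.
  by rewrite /t scalerA mulrN divff // scaleN1r subrr.
exists l => //; split=> [u v Gu Gv|u v]; first by rewrite lE Gd // addr0.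
by rewrite (lfD ll) !lE (ad v) addrACA subrr addr0.
Qed.

End Core.

(** * Homogeneous generators and extension of homomorphisms *)

Section Generators.
Variables (k : fieldType) (F : algebra k) (p : grading F).

Let lp := gp_linear p.
Let lM := mul_bilin F.

Definition homogeneous (n : nat) (x : F) : Prop :=
  forall m, p m x = if m == n then x else 0.

Lemma homogeneous_gp n x : homogeneous n (p n x).
Proof. by move=> m; rewrite gp_gp. Qed.

Lemma gp_eq0 x : (forall n, p n x = 0) -> x = 0.
Proof. by move=> x0; have [n ->] := gp_fin p x; rewrite big1. Qed.

Lemma gp_sum x n : (forall m, (n <= m)%N -> p m x = 0) ->
  x = \sum_(i < n) p i x.
Proof.
move=> nx; apply/subr0_eq/gp_eq0 => m.
rewrite (lfB (lp m)) (lf_sum (lp m)).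
case: (ltnP m n) => [mn|nm]; last first.
  rewrite nx // sub0r big1 ?oppr0 // => i _; rewrite gp_gp; case: eqP => // mi.
  by move: nm; rewrite mi leqNgt ltn_ord.
rewrite (bigD1 (Ordinal mn)) //= gp_gp eqxx big1 ?addr0 ?subrr // => i im.
by rewrite gp_gp eq_sym -[_ == m]/(i == Ordinal mn) (negPf im).
Qed.

Definition square (G : set F) : set F :=
  lspan [set w | exists u v, [/\ G u, G v & w = u ** v]].

(** By induction on the degree: a product of degree [n] is a sum of products of
components of degrees less than [n], because there is no component of degree
0. *)
Lemma graded_generated (G Y P : set F) : graded_sub p G ->
    (forall y, Y y -> exists n, homogeneous n y) ->
    [set x | G x /\ exists n, homogeneous n x] `<=` lspan (square G `|` Y) ->
    subspace P -> (forall u v, G u -> G v -> P u -> P v -> P (u ** v)) ->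
    Y `<=` P ->
  G `<=` P.
Proof.
move=> [sG mG pG] hY span_GY sP mP YP x Gx.
have Pgp n z : G z -> P (p n z).
  elim/ltn_ind: n z => n IH z Gz.
  have : lspan (square G `|` Y) (p n z).
    by apply: span_GY; split; [exact: pG | exists n; exact: homogeneous_gp].
  pose Q := [set w | P (p n w)].
  have sQ : subspace Q.
    split=> [|a u v Qu Qv]; rewrite /Q /= ?(lf0 (lp n)); first exact: sP.1.
    by rewrite lp; exact: sP.2.
  move=> /(lspan_min sQ) => QE; suff : Q (p n z) by rewrite /Q /= gp_gp eqxx.
  apply: QE => w [|Yw]; last first.
    have [d hw] := hY w Yw; rewrite /Q /= hw; case: eqP => _; first exact: YP.
    exact: sP.1.
  apply: lspan_min => // {}w [u [v [Gu Gv ->]]].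
  rewrite /Q /= gpM; apply: (subspace_sum sP) => i _.
  have [i0|i0] := posnP i; first by rewrite i0 gp0 (bl0l lM); exact: sP.1.
  have [im|im] := eqVneq (i : nat) n.
    by rewrite im subnn gp0 (bl0r lM); exact: sP.1.
  have ni : (i < n)%N by rewrite ltn_neqAle im -ltnS ltn_ord.
  apply: mP; try exact: pG; apply: IH => //.
  by rewrite ltn_subrL i0 (leq_ltn_trans _ ni).
have [n ->] := gp_fin p x.
by apply: (subspace_sum sP) => i _; exact: Pgp.
Qed.

End Generators.

Section HomExtension.
Variables (k : fieldType) (char0 : [pchar k] =i pred0).
Variables (alpha : k) (F : algebra k) (p : grading F).
Hypothesis integrable_F : forall n, integrable alpha p n.

Let lp := gp_linear p.
Let lM := mul_bilin F.

Variables (G Y : set F).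
Hypothesis gG : graded_sub p G.
Hypothesis hY : forall y, Y y -> exists n, homogeneous p n y.
Hypothesis iY : indep (square G) Y.
Variables (B : algebra k) (VB : cubic_variety alpha B) (f : F -> B).

Let lB := mul_bilin B.

Definition hom_upto n (h : F -> B) : Prop :=
  [/\ linear h, {in Y, h =1 f} &
    forall a c u v, G u -> G v -> (a + c <= n)%N ->
      h (p a u ** p c v) = h (p a u) ** h (p c v)].

Lemma hom_upto0 : exists h, hom_upto 0 h.
Proof.
have l0 : linear (fun _ : F => 0 : B) by move=> a x y; rewrite scaler0 addr0.
have [h lh [_ hf]] := linear_extension_indep f (lspan_subspace _) iY l0.
exists h; split=> // a c u v _ _; rewrite leqn0 addn_eq0 => /andP[/eqP-> _].
by rewrite gp0 (bl0l lM) (lf0 lh) (bl0l lB).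
Qed.

(** In degree [n.+1] the product [h u * h v] is a cocycle on [G], by multiplicativity
in lower degrees and since the power series with coefficients in [B] satisfy the
identity. Its integral, changed to [f] on [Y], replaces [h] in degree [n.+1] and
only there. *)
Lemma hom_uptoS n h : hom_upto n h ->
  exists h', hom_upto n.+1 h' /\ forall x, p n.+1 x = 0 -> h' x = h x.
Proof.
move=> [lh hf hM]; have [sG mG pG] := gG.
pose b u v := conv (fun i => h (p i u)) (fun i => h (p i v)) n.+1.
have lhp i : linear (fun x => h (p i x)) by exact: lin_comp lh (lp i).
have lb : bilin b.
  split=> [v|u].
    apply: (@linS k F B n.+2 (fun i u => h (p i u) ** h (p (n.+1 - i)%N v))) => i.
    exact: lin_comp (lB.1 _) (lhp i).
  apply: (@linS k F B n.+2 (fun i v => h (p i u) ** h (p (n.+1 - i)%N v))) => i.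
  exact: lin_comp (lB.2 _) (lhp _).
have bgp a c x y : b (p a x) (p c y) =
    if (a + c == n.+1)%N then h (p a x) ** h (p c y) else 0.
  rewrite /b /conv; case: eqP => [acn|acn].
    have an : (a < n.+2)%N by rewrite -acn ltnS leq_addr.
    have nac : (n.+1 - a)%N = c by rewrite -acn addKn.
    rewrite (bigD1 (Ordinal an)) //= gp_gp eqxx nac gp_gp eqxx.
    rewrite big1 ?addr0 // => i ia.
    rewrite gp_gp -[_ == a]/(i == Ordinal an) (negPf ia) (lf0 lh).
    exact: bl0l lB _.
  rewrite big1 // => i _; rewrite gp_gp; case: eqP => [ia|_]; last first.
    by rewrite (lf0 lh) (bl0l lB).
  rewrite gp_gp; case: eqP => [ic|_]; last by rewrite (lf0 lh) (bl0r lB).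
  by case: acn; rewrite -ia -ic subnKC // -ltnS.
have db : degree_le p n.+1 b.
  by move=> a c x y nac; rewrite bgp eqn_leq leqNgt nac.
have cb : cocycle_on alpha G b.
  move=> x Gx; pose g i := h (p i x).
  have g0 : g 0%N = 0 by rewrite /g gp0 (lf0 lh).
  have hxx m : (m <= n)%N -> h (p m (x ** x)) = conv g g m.
    move=> mn; rewrite gpM (lf_sum lh); apply: eq_bigr => i _.
    by rewrite hM // subnKC // -ltnS.
  have bl : b x (x ** x) = conv g (conv g g) n.+1.
    apply: eq_bigr => i _; rewrite -/(g i).
    have [i0|i0] := posnP i; first by rewrite i0 g0 !(bl0l lB).
    by rewrite hxx // -ltnS ltn_subrL i0.
  have br : b (x ** x) x = conv (conv g g) g n.+1.
    apply: eq_bigr => i _; rewrite -/(g _).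
    have [im|im] := eqVneq (i : nat) n.+1.
      by rewrite im subnn g0 !(bl0r lB).
    by rewrite hxx // -ltnS ltn_neqAle im -ltnS ltn_ord.
  rewrite bl br; exact: (congr1 (@^~ n.+1) (seq_algebra_cubic char0 VB g)).
have [l ll [lE _]] := integrable_F lb db gG cb.
have [q lq [ql qf]] := linear_extension_indep f (lspan_subspace _) iY ll.
exists (fun x => h x + (q (p n.+1 x) - h (p n.+1 x))); split; last first.
  by move=> x ->; rewrite (lf0 lq) (lf0 lh) subrr addr0.
have keep a u : (a <= n)%N ->
    h (p a u) + (q (p n.+1 (p a u)) - h (p n.+1 (p a u))) = h (p a u).
  move=> an; rewrite gp_gp gtn_eqF ?ltnS //.
  by rewrite (lf0 lq) (lf0 lh) subrr addr0.
split.
- apply: linD => //; apply: linB => //; exact: lin_comp lq (lp _).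
- move=> y Yy; have [d hy] := hY (set_mem Yy); rewrite hy; case: eqP => _.
    by rewrite addrC subrK qf.
  by rewrite (lf0 lq) (lf0 lh) subrr addr0 hf.
move=> a c u v Gu Gv acn.
have [a0|a0] := posnP a.
  by rewrite a0 gp0 (bl0l lM) (lf0 (lp _)) (lf0 lq) (lf0 lh) subrr addr0 (bl0l lB).
have [c0|c0] := posnP c.
  by rewrite c0 gp0 (bl0r lM) (lf0 (lp _)) (lf0 lq) (lf0 lh) subrr addr0 (bl0r lB).
have an : (a <= n)%N.
  by rewrite -ltnS; apply: leq_trans acn; rewrite -addn1 leq_add2l.
have cn : (c <= n)%N.
  by rewrite -ltnS; apply: leq_trans acn; rewrite -add1n leq_add2r.
rewrite !keep //.
rewrite gpMM; case: eqP => [e|/eqP ne].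
  rewrite addrC subrK ql; last first.
    apply: mem_set; apply: sub_lspan; exists (p a u), (p c v).
    by split=> //; exact: pG.
  by rewrite lE ?bgp -?e ?eqxx //; exact: pG.
rewrite (lf0 lq) (lf0 lh) subrr addr0 hM //.
by rewrite -ltnS ltn_neqAle eq_sym ne.
Qed.

(** The successive extensions agree on each element from its degree on, so they
have a limit. *)
Lemma hom_extension : exists h : F -> B,
  [/\ linear h, {in Y, h =1 f} &
      forall u v, G u -> G v -> h (u ** v) = h u ** h v].
Proof.
pose step n (h : {h | hom_upto n h}) : {h | hom_upto n.+1 h} :=
  let: exist h' H := cid (hom_uptoS (projT2 h)) in exist _ h' H.1.
pose hs := nat_rect (fun n => {h | hom_upto n h}) (cid hom_upto0) step.
pose g n := projT1 (hs n).
have gP n : hom_upto n (g n) := projT2 (hs n).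
have gS n x : p n.+1 x = 0 -> g n.+1 x = g n x.
  rewrite /g /= /step; case: (cid _) => h' [? H] /=; exact: H.
pose N x := projT1 (cid (gp_bound p x)).
have NP x m : (N x <= m)%N -> p m x = 0 by rewrite /N; case: (cid _) => n /= /(_ m).
pose h x := g (N x) x.
have hg x n : (N x <= n)%N -> h x = g n x.
  elim: n => [|n IH]; first by rewrite leqn0 /h => /eqP->.
  rewrite leq_eqVlt => /orP[/eqP<- //|Nn].
  by rewrite gS ?IH // NP // ltnW.
exists h; split=> [a x y|y Yy|u v Gu Gv].
- pose n := (N x + N y + N (a *: x + y)%R)%N; have [lg _ _] := gP n.
  rewrite !(@hg _ n) ?lg // /n ?leq_addl //.
    by rewrite addnAC leq_addl.
  by rewrite -addnA leq_addr.
- by have [_ gf _] := gP (N y); exact: gf.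
pose n := (N u + N v + N (u ** v)%A)%N; have [lg _ gM] := gP n.
have un : (N u <= n)%N by rewrite /n -addnA leq_addr.
have vn : (N v <= n)%N by rewrite /n addnAC leq_addl.
rewrite !(@hg _ n) ?leq_addl //.
rewrite [in LHS](gp_sum (NP u)) [in LHS](gp_sum (NP v)).
rewrite [in RHS](gp_sum (NP u)) [in RHS](gp_sum (NP v)).
rewrite (bl_suml lM) !(lf_sum lg) (bl_suml lB); apply: eq_bigr => i _.
rewrite (bl_sumr lM) (lf_sum lg) (bl_sumr lB); apply: eq_bigr => j _.
apply: gM => //; rewrite /n; apply: (leq_trans _ (leq_addr _ _)).
by apply: leq_add; exact: ltnW.
Qed.

End HomExtension.

(** * Leading forms of a subalgebra *)

Section LeadingForms.
Variables (k : fieldType) (F : algebra k) (p : grading F).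

Let lp := gp_linear p.
Let lM := mul_bilin F.

(** Degree at most [n], with component [x] in degree [n]; here [x] may be 0. *)
Definition leading n (s x : F) : Prop :=
  (forall m, (n < m)%N -> p m s = 0) /\ p n s = x.

Lemma leadingM a b s t x y : leading a s x -> leading b t y ->
  leading (a + b) (s ** t) (x ** y).
Proof.
move=> [s0 sx] [t0 ty]; have st0 m i : (a + b <= m)%N -> i != a ->
    (i <= m)%N -> p i s ** p (m - i)%N t = 0.
  move=> abm ia im; have [ai|ai] := ltnP a i; first by rewrite s0 ?(bl0l lM).
  rewrite t0 ?(bl0r lM) // ltn_subRL; apply: leq_trans abm.
  by rewrite ltn_add2r ltn_neqAle ia.
have am m : (a + b <= m)%N -> (a < m.+1)%N.
  by move=> abm; rewrite ltnS (leq_trans (leq_addr b a)).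
split=> [m abm|].
  rewrite gpM (bigD1 (Ordinal (am m (ltnW abm)))) //= t0 ?ltn_subRL // (bl0r lM).
  rewrite add0r big1 // => i ia; apply: st0; first exact: ltnW.
    exact: ia.
  by rewrite -ltnS.
rewrite gpM (bigD1 (Ordinal (am _ (leqnn _)))) //= addKn sx ty big1 ?addr0 //.
move=> i ia; apply: st0 => //.
by rewrite -ltnS.
Qed.

Definition leading_forms (S : set F) : set F :=
  [set x | forall n, exists2 s, S s & leading n s (p n x)].

Lemma leadingP a n s t x y : leading n s x -> leading n t y ->
  leading n (a *: s + t) (a *: x + y).
Proof.
move=> [s0 sx] [t0 ty]; split=> [m nm|]; rewrite lp ?sx ?ty //.
by rewrite s0 // t0 // scaler0 addr0.
Qed.

Lemma leading0 n : leading n 0 0.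
Proof. by split=> [m _|]; rewrite (lf0 (lp _)). Qed.

Lemma leading_sum n r (f g : nat -> F) :
  (forall i, (i < r)%N -> leading n (f i) (g i)) ->
  leading n (\sum_(i < r) f i) (\sum_(i < r) g i).
Proof.
elim: r => [|r IH] fg; first by rewrite !big_ord0; exact: leading0.
rewrite !big_ord_recr /= -[\sum_(i < r) f i]scale1r.
rewrite -[\sum_(i < r) g i]scale1r; apply: leadingP; last exact: fg.
by apply: IH => i ir; apply: fg; exact: ltnW.
Qed.

Variable S : subalgebra F.

Lemma subalg_subspace : subspace S.
Proof. by split=> [|a x y]; [exact: subalg0 | exact: subalgP]. Qed.

Lemma leading_form_gp n s : subalg_set S s -> (forall m, (n < m)%N -> p m s = 0) ->
  leading_forms S (p n s).
Proof.
move=> Ss s0 m; rewrite gp_gp; case: eqP => [->|_].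
  by exists s.
by exists 0; [exact: subalg0 | exact: leading0].
Qed.

(** The product is closed because, for lifts of the components of [x] and [y],
each product of lifts in degrees [i] and [n - i] has degree at most [n]. *)
Lemma leading_forms_graded : graded_sub p (leading_forms S).
Proof.
split.
- split=> [n|a x y Sx Sy n].
    rewrite (lf0 (lp n)).
    by exists 0; [exact: subalg0 | exact: leading0].
  have [s Ss sx] := Sx n; have [t St ty] := Sy n.
  by exists (a *: s + t); [exact: subalgP | rewrite lp; exact: leadingP].
- move=> x y Sx Sy n.
  have Sx' i : exists s, subalg_set S s /\ leading i s (p i x).
    by have [s] := Sx i; exists s.
  have Sy' i : exists s, subalg_set S s /\ leading i s (p i y).
    by have [s] := Sy i; exists s.
  have [f fP] := choice Sx'.
  have [g gP] := choice Sy'.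
  exists (\sum_(i < n.+1) f i ** g (n - i)%N).
    apply: (subspace_sum subalg_subspace) => i _.
    by apply: subalgM; [exact: (fP i).1 | exact: (gP _).1].
  rewrite gpM; apply: (leading_sum (f := fun i => f i ** g (n - i)%N)
    (g := fun i => p i x ** p (n - i)%N y)) => i.
  rewrite ltnS => /subnKC {1}<-.
  by apply: leadingM; [exact: (fP i).2 | exact: (gP _).2].
- move=> n x Sx m; rewrite gp_gp; case: eqP => [->|_]; first exact: Sx.
  by exists 0; [exact: subalg0 | exact: leading0].
Qed.

End LeadingForms.

(** * The subalgebra is isomorphic to its algebra of leading forms *)

(** Throughout, [theta] is a homomorphism on [G] which sends each generator [y] to
an element [f y] of [S] with leading form [y]. *)
Section Lift.
Variables (k : fieldType) (F : algebra k) (p : grading F) (S : subalgebra F).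

Let lp := gp_linear p.
Let lM := mul_bilin F.
Let G := leading_forms p S.
Let gG : graded_sub p G := leading_forms_graded p S.

Variables (Y : set F) (f : F -> F) (theta : F -> F).
Hypothesis hY : forall y, Y y -> exists n, homogeneous p n y.
Hypothesis span_GY :
  [set x | G x /\ exists n, homogeneous p n x] `<=` lspan (square G `|` Y).
Hypothesis fY : forall y, Y y -> subalg_set S (f y) /\
  exists2 n, homogeneous p n y & leading p n (f y) y.
Hypothesis ltheta : linear theta.
Hypothesis thetaM : forall u v, G u -> G v -> theta (u ** v) = theta u ** theta v.
Hypothesis thetaY : {in Y, theta =1 f}.

Lemma theta_leading x n : G x -> leading p n (theta (p n x)) (p n x).
Proof.
have [sG mG pG] := gG.
pose P := [set x | forall n, leading p n (theta (p n x)) (p n x)].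
move=> Gx; suff : G `<=` P by move=> /(_ x Gx).
apply: (graded_generated gG hY span_GY).
- split=> [m|a u v Pu Pv m].
    by rewrite (lf0 (lp m)) (lf0 ltheta); exact: leading0.
  by rewrite lp ltheta; exact: leadingP.
- move=> u v Gu Gv Pu Pv m; rewrite gpM (lf_sum ltheta).
  apply: (leading_sum (f := fun i => theta (p i u ** p (m - i)%N v))
    (g := fun i => p i u ** p (m - i)%N v)) => i.
  rewrite ltnS => /subnKC {1}<-; rewrite thetaM; try exact: pG.
  by apply: leadingM; [exact: Pu | exact: Pv].
move=> y Yy m; have [_ [d hy ly]] := fY Yy; rewrite hy; case: eqP => [->|_].
  by rewrite thetaY ?mem_set.
by rewrite (lf0 ltheta); exact: leading0.
Qed.

Lemma theta_sub x : G x -> subalg_set S (theta x).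
Proof.
have sS := subalg_subspace S.
move=> Gx; suff : G `<=` [set x | subalg_set S (theta x)] by move=> /(_ x Gx).
apply: (graded_generated gG hY span_GY).
- split=> [|a u v Su Sv] /=; first by rewrite (lf0 ltheta); exact: sS.1.
  by rewrite ltheta; exact: sS.2.
- by move=> u v Gu Gv Su Sv /=; rewrite thetaM //; exact: subalgM.
by move=> y Yy /=; rewrite thetaY ?mem_set //; exact: (fY Yy).1.
Qed.

(** The component of top degree of [x] is also that of [theta x]. *)
Lemma theta_inj0 x : G x -> theta x = 0 -> x = 0.
Proof.
have [sG mG pG] := gG.
have [n nx] := gp_bound p x.
elim: n nx => [|n IH] nx Gx x0; first by apply: (gp_eq0 (p := p)) => m; exact: nx.
apply: (IH _ Gx x0) => m; rewrite leq_eqVlt => /orP[/eqP<-|]; last exact: nx.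
have : p n (theta x) = 0 by rewrite x0 (lf0 (lp n)).
rewrite {1}(gp_sum nx) (lf_sum ltheta) big_ord_recr /= (lfD (lp n)).
rewrite (lf_sum (lp n)) big1 => [|i _].
  by rewrite add0r (theta_leading n Gx).2.
have [l0 _] := theta_leading i Gx; exact: l0 (ltn_ord i).
Qed.

(** Subtracting from [s] the image of its leading form lowers the degree. *)
Lemma theta_surj s : subalg_set S s -> exists2 x, G x & theta x = s.
Proof.
have [sG mG pG] := gG; have sS := subalg_subspace S.
have [n ns] := gp_bound p s.
elim: n s ns => [|n IH] s ns Ss.
  exists 0; first exact: sG.1.
  rewrite (lf0 ltheta); by apply/esym/(gp_eq0 (p := p)) => m; exact: ns.
have Gx : G (p n s) by apply: leading_form_gp.
have := theta_leading n Gx; rewrite gp_gp eqxx => -[l0 lx].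
have [m||y Gy ty] := IH (s - theta (p n s)).
- rewrite leq_eqVlt (lfB (lp m)) => /orP[/eqP<-|nm].
    by rewrite lx subrr.
  by rewrite l0 // ns // subrr.
- by apply: (subspaceB sS Ss); exact: theta_sub.
exists (y + p n s); first exact: (subspaceD sG Gy).
by rewrite (lfD ltheta) ty subrK.
Qed.

End Lift.

Theorem mainTheorem7 (k : fieldType) (char0 : [pchar k] =i pred0)
    (alpha : k) (alpha_neq1 : alpha <> 1) :
  nielsen_schreier (@cubic_variety k alpha).
Proof.
move=> F [X [i free_i]] S.
have [p] := free_grading char0 free_i.
have int_F n : integrable alpha p n.
  apply: (all_integrable char0 alpha_neq1) => M b lb cb.
  by apply: (free_cocycle free_i lb) => x; exact: cb.
set G := leading_forms p S.
have gG : graded_sub p G := leading_forms_graded p S.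
have [sG mG pG] := gG.
have [Y [YE iY span_GY]] :=
  exists_basis (square G) [set x | G x /\ exists n, homogeneous p n x].
have GY : Y `<=` G by move=> y /YE[].
have hY y : Y y -> exists n, homogeneous p n y by move=> /YE[].
have lift y : exists s, Y y -> subalg_set S s /\
    exists2 n, homogeneous p n y & leading p n s y.
  have [Yy|nYy] := pselect (Y y); last by exists 0.
  have [n hy] := hY y Yy; have [s Ss sy] := GY y Yy n.
  by exists s => _; split=> //; exists n => //; move: sy; rewrite hy eqxx.
have [f fY] := choice lift.
have [theta [ltheta thetaY thetaM]] :=
  hom_extension char0 int_F gG hY iY free_i.1 f.
have theta_S := theta_sub hY span_GY fY ltheta thetaM thetaY.
have theta_inj u v : G u -> G v -> theta u = theta v -> u = v.
  move=> Gu Gv uv; apply: subr0_eq.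
  apply: (theta_inj0 hY span_GY fY ltheta thetaM thetaY) => //.
    exact: (subspaceB sG Gu Gv).
  by rewrite (lfB ltheta) uv subrr.
(* Homomorphisms on S are those on G composed with g, the inverse of theta. *)
have inv s : exists x, G x /\ theta x = val (s : subalg_algebra S).
  have [x Gx xs] := theta_surj hY span_GY fY ltheta thetaM thetaY
    (set_mem (valP s)).
  by exists x.
have [g gP] := choice inv.
have lg : linear g.
  move=> a u v; have [Gu gu] := gP u; have [Gv gv] := gP v.
  have [Guv guv] := gP (a *: u + v).
  by apply: theta_inj => //; [exact: sG.2 | rewrite ltheta gu gv guv].
have gM u v : g (u ** v) = g u ** g v.
  have [Gu gu] := gP u; have [Gv gv] := gP v; have [Guv guv] := gP (u ** v).
  by apply: theta_inj; rewrite ?thetaM ?gu ?gv //; exact: mG.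
pose j (y : {y | Y y}) : subalg_algebra S :=
  Sub (f (sval y)) (mem_set (fY _ (svalP y)).1).
have gj y : g (j y) = sval y.
  have [Gy gy] := gP (j y).
  apply: theta_inj => //; first exact/GY/(svalP y).
  by rewrite gy thetaY // mem_set //; exact: (svalP y).
exists {y | Y y}, j; split=> [u|B b VB].
  by apply: val_inj; rewrite /= free_i.1.
pose b' x := if pselect (Y x) is left Yx then b (exist _ x Yx) else 0.
have [h [lh hY' hM]] := hom_extension char0 int_F gG hY iY VB b'.
have hb y : h (sval y) = b y.
  rewrite hY' ?mem_set //; last exact: (svalP y).
  rewrite /b'; case: pselect => [Yy|]; last by case; exact: (svalP y).
  by congr b; case: y Yy => y Yy Yy'; exact/eq_exist.
exists (fun s => h (g s)) => [|h' [lh' mh'] h'j s].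
  split=> [|y]; last by rewrite gj hb.
  split=> [a u v|u v]; first by rewrite lg lh.
  by rewrite gM hM //; [exact: (gP u).1 | exact: (gP v).1].
pose P := [set x | exists2 u : subalg_algebra S,
  val u = theta x & h' u = h x].
have [Gs gs] := gP s.
suff [u us <-] : P (g s) by congr h'; apply: val_inj; rewrite us gs.
move: (g s) Gs; rewrite -/(G `<=` P); apply: (graded_generated gG hY span_GY).
- split=> [|a x y [u ux hu] [v vy hv]].
    by exists 0; rewrite ?(lf0 ltheta) // (lf0 lh') (lf0 lh).
  exists (a *: u + v); first by rewrite /= ltheta -ux -vy.
  by rewrite lh' hu hv lh.
- move=> x y Gx Gy [u ux hu] [v vy hv]; exists (u ** v).
    by rewrite /= thetaM // -ux -vy.
  by rewrite mh' hu hv hM.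
move=> y Yy; exists (j (exist _ y Yy)); first by rewrite /= thetaY // mem_set.
by rewrite h'j -hb.
Qed.
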